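(* Let $k\ge1$, $c,r\ge1$ with $c+r=k+1$ and $R=(c^r)$. Then $$Y_R:=\sum_{\gamma\in\Gamma}{\bf u}(z_\gamma)\;=\;W_R:=\sum_{B}{\bf u}(j_B),$$ where $B$ ranges over all $c$-element subsets of $\{1,\dots,k+1\}$.
   Context: Indices are modulo $k+1$. $W$ is the affine symmetric group with generators $s_0,\dots,s_k$ (relations $s_i^2=1$, $s_is_j=s_js_i$ for $i-j\not\equiv\pm1$, $s_is_{i+1}s_i=s_{i+1}s_is_{i+1}$); $\mathbb{A}$ is the affine nilCoxeter algebra with generators $u_0,\dots,u_k$ (relations $u_i^2=0$ and the same commutation and braid relations); for $w\in W$ with reduced word $s_{i_1}\cdots s_{i_m}$, ${\bf u}(w)=u_{i_1}\cdots u_{i_m}$. Let $V=\mathbb{R}^{k+1}/\mathbb{R}(1,\dots,1)$ with $W$-action: for $i\ne0$, $s_i\diamond a$ swaps coordinates $i,i+1$; $s_0\diamond(a_1,\dots,a_{k+1})=(a_{k+1}+1,a_2,\dots,a_k,a_1-1)$. Weights are images of $\mathbb{Z}^{k+1}$; $A_\emptyset=\{a:a_1\ge\dots\ge a_{k+1}\ge a_1-1\}$, $A_w=w^{-1}\diamond A_\emptyset$; for a weight $\gamma$, $z_\gamma$ is the unique element of $W$ with $A_{z_\gamma}=A_\emptyset+\gamma$. $\Gamma$ is the set of elements of $V$ represented by a $\{0,1\}$-vector with coordinate sum $c$. $W$ is identified with the group of bijections $w:\mathbb{Z}\to\mathbb{Z}$ with $w(i+k+1)=w(i)+k+1$ and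 $\sum_{i=1}^{k+1}w(i)=\binom{k+2}{2}$, composition of functions as product, where $s_i(j)=j+1$ if $j\equiv i$, $s_i(j)=j-1$ if $j\equiv i+1$, $s_i(j)=j$ otherwise (mod $k+1$). For a $c$-subset $B\subseteq\{1,\dots,k+1\}$, $j_B\in W$ is the element with $j_B(i)=i-r$ if $i\in B$ and $j_B(i)=i+c$ if $i\notin B$, for $1\le i\le k+1$. *)

(* Defs.v *)
From HB Require Import structures.
From mathcomp Require Import all_boot all_order all_algebra.
From mathcomp Require Import perm generic_quotient ring_quotient.
From mathcomp Require Import ring lra zify.
From mathcomp Require Import mathcomp_extra boolp classical_sets functions.
From mathcomp Require Import cardinality fsbigop reals.
From mathcomp.multinomials Require Import monalg.

Set Implicit Arguments.
Unset Strict Implicit.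
Unset Printing Implicit Defensive.

Import Order.TTheory GRing.Theory Num.Theory.

Local Open Scope ring_scope.
Local Open Scope quotient_scope.

(** * The affine symmetric group *)

Definition affine_perm (k : nat) (f : int -> int) : Prop :=
  [/\ bijective f,
      forall i : int, f (i + k.+1%:Z) = f i + k.+1%:Z
    & \sum_(1 <= i < k.+2) f i%:Z = 'C(k.+2, 2)%:Z].

Definition affine_symm (k : nat) : Type :=
  {f : int -> int | `[< affine_perm k f >]}.

HB.instance Definition _ k := SubType.on (affine_symm k).
HB.instance Definition _ k := [Choice of affine_symm k by <:].

Definition affine_fun (k : nat) (w : affine_symm k) : int -> int := val w.
Coercion affine_fun : affine_symm >-> Funclass.

Section AffineSymmGroup.
Variable k : nat.
Implicit Types v w : affine_symm k.

Lemma affine_symmP w : affine_perm k w.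
Proof. exact/asboolP/(valP w). Qed.

Lemma affine_symm_eq v w : v =1 w -> v = w.
Proof. by move=> vw; apply/val_inj/funext. Qed.

Lemma affine_perm_id : affine_perm k id.
Proof.
split=> //; first by exists id.
rewrite -(big_morph Posz PoszD (erefl _)) -bin2_sum; congr Posz.
by rewrite [RHS]big_ltn.
Qed.

Lemma affine_perm_add f : affine_perm k f -> forall (i m : int),
  f (i + m * k.+1%:Z) = f i + m * k.+1%:Z.
Proof.
case=> _ fD _ i m.
have fDn (n : nat) j : f (j + n%:Z * k.+1%:Z) = f j + n%:Z * k.+1%:Z.
  elim: n => [|n IHn]; first by rewrite !mul0r !addr0.
  by rewrite -addn1 PoszD !mulrDl !mul1r !addrA fD IHn.
case: m => n; first exact: fDn.
rewrite NegzE mulNr; apply: (addIr (n.+1%:Z * k.+1%:Z)).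
by rewrite -fDn !subrK.
Qed.

Definition residue (x : int) : 'I_k.+1 := inord `|(x %% k.+1)%Z|%N.

Lemma residueE x : (residue x : int) = (x %% k.+1)%Z.
Proof.
rewrite inordK; first by rewrite gez0_abs ?modz_ge0.
by rewrite -ltz_nat gez0_abs ?modz_ge0 ?ltz_pmod.
Qed.

Lemma residue_eq x y : residue x = residue y -> exists m, x = y + m * k.+1%:Z.
Proof.
move/(congr1 (fun i : 'I_k.+1 => (i : nat)%:Z)); rewrite !residueE => xy.
exists ((x %/ k.+1)%Z - (y %/ k.+1)%Z).
rewrite {1}(divz_eq x k.+1) {1}(divz_eq y k.+1) xy; ring.
Qed.

Lemma periodic_residue (V : zmodType) (h : int -> V) :
  (forall x, h (x + k.+1%:Z) = h x) -> forall x, h (residue x : nat)%:Z = h x.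
Proof.
move=> hD x.
have hDn (n : nat) j : h (j + n%:Z * k.+1%:Z) = h j.
  elim: n => [|n IHn]; first by rewrite mul0r addr0.
  by rewrite -addn1 PoszD mulrDl mul1r addrA hD.
have hDm m j : h (j + m * k.+1%:Z) = h j.
  case: m => n; first exact: hDn.
  by rewrite NegzE mulNr -(hDn n.+1) subrK.
by rewrite residueE [in RHS](divz_eq x k.+1) addrC hDm.
Qed.

Lemma sum_residues (V : zmodType) (h : int -> V) (phi : 'I_k.+1 -> int) :
  (forall x, h (x + k.+1%:Z) = h x) -> injective (residue \o phi) ->
  \sum_i h (phi i) = \sum_(i < k.+1) h (i : nat)%:Z.
Proof.
move=> hD phi_inj; rewrite [RHS](reindex (residue \o phi)) /=.
  by apply: eq_bigr => i _; rewrite periodic_residue.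
by apply: onW_bij; apply: injF_bij.
Qed.

Lemma residue_affine_inj f : affine_perm k f ->
  injective (residue \o (fun i : 'I_k.+1 => f i.+1%:Z)).
Proof.
move=> fP i j /= /residue_eq[m fij].
have f_inj : injective f by case: fP => /bij_inj.
move: fij; rewrite -(affine_perm_add fP) => /f_inj ij.
apply/val_inj/eqP; rewrite -eqz_nat /=.
have iP := ltn_ord i; have jP := ltn_ord j.
have [m0|m0|m0] := ltgtP m 0; last by move: ij; rewrite m0 mul0r; lia.
  have : m * k.+1%:Z <= -1 * k.+1%:Z by rewrite ler_pM2r //; lia.
  by lia.
have : 1 * k.+1%:Z <= m * k.+1%:Z by rewrite ler_pM2r //; lia.
by lia.
Qed.

Lemma affine_sumE f : (forall i : int, f (i + k.+1%:Z) = f i + k.+1%:Z) ->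
  (\sum_(1 <= i < k.+2) f i%:Z = 'C(k.+2, 2)%:Z) <->
  (\sum_(i < k.+1) (f (i : nat)%:Z - (i : nat)%:Z) = 0).
Proof.
move=> fD; pose h x := f x - x.
have hD x : h (x + k.+1%:Z) = h x by rewrite /h fD; ring.
have -> : \sum_(1 <= i < k.+2) f i%:Z
    = \sum_(i < k.+1) h (i : nat)%:Z + 'C(k.+2, 2)%:Z.
  have <- : \sum_(1 <= i < k.+2) i%:Z = 'C(k.+2, 2)%:Z.
    by case: affine_perm_id.
  rewrite -(sum_residues hD (residue_affine_inj affine_perm_id)).
  rewrite !big_add1 /= !big_mkord -big_split /=.
  by apply: eq_bigr => i _; rewrite /h subrK.
by split=> [|->]; [move/(canRL (addrK _)); rewrite subrr | rewrite add0r].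
Qed.

Lemma affine_perm_sum f (V : zmodType) (h : int -> V) : affine_perm k f ->
  (forall x, h (x + k.+1%:Z) = h x) ->
  \sum_(i < k.+1) h (f (i : nat)%:Z) = \sum_(i < k.+1) h (i : nat)%:Z.
Proof.
move=> fP hD; have [_ fD _] := fP.
rewrite -(sum_residues hD (residue_affine_inj fP)).
pose g x := h (f x).
have gD x : g (x + k.+1%:Z) = g x by rewrite /g fD hD.
by rewrite -(sum_residues gD (residue_affine_inj affine_perm_id)).
Qed.

Lemma affine_perm_comp f g :
  affine_perm k f -> affine_perm k g -> affine_perm k (f \o g).
Proof.
move=> fP gP; have [bf fD sf] := fP; have [bg gD sg] := gP.
have fgD i : (f \o g) (i + k.+1%:Z) = (f \o g) i + k.+1%:Z by rewrite /= gD fD.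
split=> //; first exact: bij_comp.
apply/affine_sumE => //; pose h x := f x - x.
have hD x : h (x + k.+1%:Z) = h x by rewrite /h fD; ring.
transitivity (\sum_(i < k.+1) (h (g (i : nat)%:Z) + (g (i : nat)%:Z - (i : nat)%:Z))).
  by apply: eq_bigr => i _; rewrite /h addrA subrK.
rewrite big_split /= (affine_perm_sum gP hD).
by move/(affine_sumE fD): sf => ->; move/(affine_sumE gD): sg => ->; rewrite addr0.
Qed.

Lemma affine_perm_inv f g :
  affine_perm k f -> cancel f g -> cancel g f -> affine_perm k g.
Proof.
move=> fP fK gK; have [bf fD sf] := fP.
have gD i : g (i + k.+1%:Z) = g i + k.+1%:Z by apply: (can_inj fK); rewrite fD !gK.
split=> //; first by exists f.
apply/affine_sumE => //; pose h x := g x - x.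
have hD x : h (x + k.+1%:Z) = h x by rewrite /h gD; ring.
rewrite -(affine_perm_sum fP hD).
under eq_bigr => i _ do rewrite /h fK -opprB.
by rewrite sumrN; move/(affine_sumE fD): sf => ->; rewrite oppr0.
Qed.

Definition affine_mk f (fP : affine_perm k f) : affine_symm k :=
  Sub f (introT (asboolP _) fP).

Definition affine_one : affine_symm k := affine_mk affine_perm_id.

Definition affine_mul v w : affine_symm k :=
  affine_mk (affine_perm_comp (affine_symmP v) (affine_symmP w)).

Lemma affine_inv_ex w : exists v : affine_symm k, cancel w v /\ cancel v w.
Proof.
have [[g fK gK] _ _] := affine_symmP w.
by exists (affine_mk (affine_perm_inv (affine_symmP w) fK gK)).
Qed.

Definition affine_inv w : affine_symm k := projT1 (cid (affine_inv_ex w)).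

Lemma affine_mulA : associative affine_mul.
Proof. by move=> u v w; apply: affine_symm_eq. Qed.

Lemma affine_mul1 : left_id affine_one affine_mul.
Proof. by move=> w; apply: affine_symm_eq. Qed.

Lemma affine_mulr1 : right_id affine_one affine_mul.
Proof. by move=> w; apply: affine_symm_eq. Qed.

Lemma affine_mulV : left_inverse affine_one affine_inv affine_mul.
Proof.
move=> w; apply: affine_symm_eq => i; rewrite /affine_inv.
by case: cid => v [wK vK]; apply: wK.
Qed.

Lemma affine_mulrV : right_inverse affine_one affine_inv affine_mul.
Proof.
move=> w; apply: affine_symm_eq => i; rewrite /affine_inv.
by case: cid => v [wK vK]; apply: vK.
Qed.

HB.instance Definition _ := isGroup.Build (affine_symm k)
  affine_mulA affine_mul1 affine_mulr1 affine_mulV affine_mulrV.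

Lemma affine_symmM v w i : ((v * w)%g : affine_symm k) i = v (w i).
Proof. by []. Qed.

Lemma affine_symm1 i : (1%g : affine_symm k) i = i. Proof. by []. Qed.

Lemma affine_symmVK w : cancel w (w^-1%g : affine_symm k).
Proof. by move=> i; rewrite -affine_symmM mulVg. Qed.

Definition affine_gen_fun (i : 'I_k.+1) (j : int) : int :=
  if (j == (i : nat)%:Z %[mod k.+1])%Z then j + 1
  else if (j == (i : nat)%:Z + 1 %[mod k.+1])%Z then j - 1
  else j.

(* affine_gen_fun i is an affine permutation only for 0 < k
   (see affine_gen_perm); the default value 1 is used only for k = 0. *)
Definition affine_gen (i : 'I_k.+1) : affine_symm k :=
  insubd (1%g : affine_symm k) (affine_gen_fun i).

Hypothesis k_gt0 : (0 < k)%N.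

Lemma modz_succ_neq (x y : int) :
  (x == y %[mod k.+1])%Z -> (x == y + 1 %[mod k.+1])%Z = false.
Proof.
rewrite !eqz_mod_dvd => dxy; apply/negP => /(rpredB dxy).
have -> : x - y - (x - (y + 1)) = 1 by ring.
by rewrite dvdz1 absz_nat; case: k k_gt0.
Qed.

Variant affine_gen_spec (i : 'I_k.+1) (j : int) : int -> Type :=
  | AffineGenUp of (j == (i : nat)%:Z %[mod k.+1])%Z : affine_gen_spec i j (j + 1)
  | AffineGenDown of (j == (i : nat)%:Z + 1 %[mod k.+1])%Z : affine_gen_spec i j (j - 1)
  | AffineGenId of (j != (i : nat)%:Z %[mod k.+1])%Z
                 & (j != (i : nat)%:Z + 1 %[mod k.+1])%Z : affine_gen_spec i j j.

Lemma affine_genP i j : affine_gen_spec i j (affine_gen_fun i j).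
Proof.
rewrite /affine_gen_fun; case: ifPn => [|jNi]; first by constructor.
by case: ifPn => [|jNi1]; constructor.
Qed.

Lemma affine_gen_funK i : involutive (affine_gen_fun i).
Proof.
move=> j; case: (affine_genP i j) => [ji|ji|jNi jNi1].
- have ji1 : (j + 1 == (i : nat)%:Z + 1 %[mod k.+1])%Z.
    by move: ji; rewrite !eqz_mod_dvd opprD addrACA subrr addr0.
  rewrite /affine_gen_fun ji1 ifF ?addrK //.
  by apply/negP => /modz_succ_neq; rewrite ji1.
- have ji1 : (j - 1 == (i : nat)%:Z %[mod k.+1])%Z.
    by move: ji; rewrite !eqz_mod_dvd opprD addrA addrAC.
  by rewrite /affine_gen_fun ji1 subrK.
- by rewrite /affine_gen_fun (negPf jNi) (negPf jNi1).
Qed.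

Lemma affine_gen_perm i : affine_perm k (affine_gen_fun i).
Proof.
have sD j : affine_gen_fun i (j + k.+1%:Z) = affine_gen_fun i j + k.+1%:Z.
  by rewrite /affine_gen_fun modzDr; case: ifP => _; [ring|case: ifP => _; ring].
split=> //; first by exists (affine_gen_fun i); apply: affine_gen_funK.
apply/affine_sumE => //.
have -> : \sum_(j < k.+1) (affine_gen_fun i (j : nat)%:Z - (j : nat)%:Z)
   = \sum_(j < k.+1) ((j == i)%:Z - (j == residue ((i : nat)%:Z + 1))%:Z).
  apply: eq_bigr => j _; rewrite /affine_gen_fun.
  have -> : (j == residue ((i : nat)%:Z + 1))
    = ((j : nat)%:Z == (i : nat)%:Z + 1 %[mod k.+1])%Z.
    rewrite -val_eqE -eqz_nat residueE [in RHS]modz_small //.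
    by rewrite /= ltz_nat ltn_ord.
  have ji : (j == i) = ((j : nat)%:Z == (i : nat)%:Z %[mod k.+1])%Z.
    by rewrite -val_eqE -eqz_nat !modz_small //= ltz_nat ltn_ord.
  rewrite -ji; case: eqP => [ji'|_].
    by rewrite modz_succ_neq -?ji ?ji' //=; ring.
  by case: eqP => _ /=; ring.
have sum1 (l : 'I_k.+1) : \sum_(j < k.+1) (j == l)%:Z = 1 :> int.
  by rewrite (bigD1 l) //= eqxx big1 // => j /negPf ->.
by rewrite sumrB !sum1 subrr.
Qed.

Lemma affine_genE i : affine_gen i =1 affine_gen_fun i.
Proof.
move=> j; rewrite /affine_gen /affine_fun insubdK //.
exact/asboolP/affine_gen_perm.
Qed.

Lemma affine_genK i : (affine_gen i * affine_gen i = 1)%g.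
Proof.
by apply: affine_symm_eq => j; rewrite affine_symmM !affine_genE affine_gen_funK.
Qed.

Lemma affine_genV i : ((affine_gen i)^-1 = affine_gen i)%g.
Proof. by apply: (mulgI (affine_gen i)); rewrite mulgV affine_genK. Qed.

Definition affine_prod (s : seq 'I_k.+1) : affine_symm k :=
  (\prod_(i <- s) affine_gen i)%g.

Definition affine_size w : int :=
  \sum_(j < k.+1) (w (j : nat)%:Z - (j : nat)%:Z) ^+ 2.

Lemma affine_size_gen w i : affine_size (w * affine_gen i)%g =
  affine_size w + (w ((i : nat)%:Z + 1) - w (i : nat)%:Z) *+ 2.
Proof.
have [_ wD _] := affine_symmP w; have sP := affine_gen_perm i.
have [_ sD _] := sP; pose s := affine_gen_fun i.
pose d x := w x - x.
have dD x : d (x + k.+1%:Z) = d x by rewrite /d wD; ring.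
have d2D x : d (x + k.+1%:Z) ^+ 2 = d x ^+ 2 by rewrite dD.
rewrite /affine_size -(affine_perm_sum sP d2D).
pose e (j : int) := s j - j.
pose g j := (d (s j) * e j) *+ 2 + e j ^+ 2.
have gD x : g (x + k.+1%:Z) = g x.
  by rewrite /g /e /s sD dD opprD addrACA subrr addr0.
under eq_bigr => j _.
  rewrite affine_symmM affine_genE -/(s _).
  have -> : (w (s (j : nat)%:Z) - (j : nat)%:Z) ^+ 2 =
    d (s (j : nat)%:Z) ^+ 2 + g (j : nat)%:Z by rewrite /g /d /e; ring.
  over.
rewrite big_split /=; congr (_ + _).
pose i0 : int := (i : nat)%:Z; pose i1 := residue (i0 + 1).
have g_i : g i0 = (d (i0 + 1)) *+ 2 + 1.
  by rewrite /g /e /s /affine_gen_fun eqxx (addrC i0) addrK; ring.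
have g_i1 : g (i0 + 1) = - (d i0) *+ 2 + 1.
  rewrite /g /e /s /affine_gen_fun ifF; last first.
    by rewrite eq_sym modz_succ_neq.
  by rewrite eqxx addrK; ring.
have i1N : i1 != i.
  apply/eqP => /(congr1 (fun l : 'I_k.+1 => (l : nat)%:Z)).
  rewrite residueE => i1i.
  have : (i0 == i0 + 1 %[mod k.+1])%Z by rewrite i1i modz_small //= ltz_nat ltn_ord.
  by rewrite modz_succ_neq.
rewrite (bigD1 i) //= (bigD1 i1) //= big1 => [|j /andP[jNi jNi1]].
  rewrite -/i0 g_i (periodic_residue gD) g_i1 /d; ring.
rewrite /g /e /s /affine_gen_fun ifF; last first.
  apply: contraNF jNi => /eqP; rewrite !modz_small ?ltz_nat ?ltn_ord //= => -[ji].
  exact/eqP/val_inj.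
rewrite ifF ?subrr ?mulr0 //.
apply: contraNF jNi1 => /eqP ji; apply/eqP/val_inj/eqP.
by rewrite -eqz_nat residueE -ji modz_small //= ltz_nat ltn_ord.
Qed.

Lemma affine_descent w : w = 1%g \/
  exists i : 'I_k.+1, w ((i : nat)%:Z + 1) < w (i : nat)%:Z.
Proof.
have [_ wD ws] := affine_symmP w.
have [[i iP]|noD] := pselect (exists i : 'I_k.+1, w ((i : nat)%:Z + 1) < w (i : nat)%:Z).
  by right; exists i.
left; pose d x := w x - x.
have dD x : d (x + k.+1%:Z) = d x by rewrite /d wD; ring.
have d_incr x : d x <= d (x + 1).
  pose g y := d (y + 1) - d y.
  have gD y : g (y + k.+1%:Z) = g y by rewrite /g (addrAC y) !dD.
  rewrite -subr_ge0 -/(g x) -(periodic_residue gD) /g /d.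
  set r := residue x; set r0 := (r : nat)%:Z.
  have : ~~ (w (r0 + 1) < w r0) by apply/negP => wr; apply: noD; exists r.
  have : w (r0 + 1) != w r0.
    have [/bij_inj w_inj _ _] := affine_symmP w.
    by apply/eqP => /w_inj; lia.
  by move: (w (r0 + 1)) (w r0) => a b; lia.
have d_le (n : nat) x : d x <= d (x + n%:Z).
  elim: n => [|n IHn]; first by rewrite addr0.
  by apply: (le_trans IHn); rewrite -addn1 PoszD addrA.
have d_const x : d x = d 0.
  rewrite -(periodic_residue dD); set r := residue x.
  apply/le_anti/andP; split; last by have := d_le r 0; rewrite add0r.
  rewrite -[d 0]dD add0r.
  have -> : k.+1%:Z = (r : nat)%:Z + (k.+1 - r)%N%:Z.
    by have := ltn_ord r; lia.
  exact: d_le.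
apply: affine_symm_eq => j; rewrite affine_symm1.
have : d j = 0.
  move/(affine_sumE wD): ws; rewrite (eq_bigr (fun=> d 0)) => [|i _]; last exact: d_const.
  rewrite sumr_const card_ord d_const => /eqP.
  by rewrite mulrn_eq0 /= => /eqP.
by rewrite /d; lia.
Qed.

Lemma affine_prod_surj w : exists s, affine_prod s = w.
Proof.
have [n] := ubnP `|affine_size w|%N; elim: n w => // n IHn w.
have size_ge0 v : 0 <= affine_size v by apply: sumr_ge0 => j _; apply: sqr_ge0.
have [-> _|[i iP] wn] := affine_descent w.
  by exists [::]; rewrite /affine_prod big_nil.
have [|s sE] := IHn (w * affine_gen i)%g.
  have := affine_size_gen w i; have := size_ge0 w.
  have := size_ge0 (w * affine_gen i)%g; move: wn iP; lia.
exists (rcons s i).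
by rewrite -[RHS]mulg1 -(affine_genK i) mulgA -sE /affine_prod -cats1 big_cat big_seq1.
Qed.

End AffineSymmGroup.

Definition reduced_word (k : nat) (w : affine_symm k) (s : seq 'I_k.+1) : Prop :=
  affine_prod s = w /\
  forall t : seq 'I_k.+1, affine_prod t = w -> (size s <= size t)%N.

Definition some_reduced_word (k : nat) (w : affine_symm k) : seq 'I_k.+1 :=
  xget [::] [set s | reduced_word w s]%classic.

Lemma some_reduced_wordP (k : nat) (w : affine_symm k) :
  (0 < k)%N -> reduced_word w (some_reduced_word w).
Proof.
move=> k_gt0; apply: (xgetPex [::] (P := reduced_word w)).
have [s0 s0E] := affine_prod_surj k_gt0 w.
have [n] := ubnP (size s0); elim: n s0 s0E => // n IHn s sE sn.
have [[t [tE ts]]|min_s] :=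
  pselect (exists t, affine_prod t = w /\ (size t < size s)%N).
  exact: (IHn t tE (leq_trans ts sn)).
exists s; split=> // t tE; rewrite leqNgt; apply/negP => ts.
by apply: min_s; exists t.
Qed.

(* The ordinal i stands for the element i + 1 of {1, ..., k + 1}. *)
Section WindowElement.
Variables (k c r : nat) (B : {set 'I_k.+1}).

Definition window_spec (w : affine_symm k) : Prop :=
  forall i : 'I_k.+1,
    w (i.+1)%:Z = if i \in B then i.+1%:Z - r%:Z else i.+1%:Z + c%:Z.

Definition window_elt : affine_symm k := xget 1%g [set w | window_spec w]%classic.

Lemma window_spec_uniq v w : window_spec v -> window_spec w -> v = w.
Proof.
move=> vP wP; apply: affine_symm_eq => x.
have [m] : exists m, x = (residue k (x - 1)).+1%:Z + m * k.+1%:Z.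
  have [|m xE] := @residue_eq k (x - 1) (residue k (x - 1) : nat)%:Z.
    by apply/val_inj/eqP; rewrite -eqz_nat !residueE modz_mod.
  by exists m; rewrite -addn1 PoszD addrAC -xE subrK.
move=> ->; rewrite !(affine_perm_add (affine_symmP _)).
by rewrite vP wP.
Qed.

Lemma window_eltP : (c + r = k.+1)%N -> #|B| = c -> window_spec window_elt.
Proof.
move=> crk cB; apply: (xgetPex 1%g (P := window_spec)).
pose inB (x : int) := residue k (x - 1) \in B.
have res_shift x y m : x = y + m * k.+1%:Z -> inB x = inB y.
  move=> ->; rewrite /inB; congr (_ \in B); apply/val_inj/eqP.
  by rewrite -eqz_nat !residueE addrAC addrC modzMDl.
have kE : k.+1%:Z = c%:Z + r%:Z by rewrite -crk PoszD.
pose f x : int := if inB x then x - r%:Z else x + c%:Z.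
pose g x : int := if inB (x + r%:Z) then x + r%:Z else x - c%:Z.
have fD x : f (x + k.+1%:Z) = f x + k.+1%:Z.
  rewrite /f (res_shift _ x 1) ?mul1r //; case: ifP => _; ring.
have fP : affine_perm k f.
  split=> //.
    exists g => x.
      rewrite /f; case: ifPn => [xB|xNB]; rewrite /g ?subrK ?xB //.
      by rewrite (res_shift _ x 1) ?(negPf xNB) ?addrK // kE; ring.
    rewrite /g; case: ifPn => [xB|xNB]; rewrite /f ?xB ?addrK //.
    by rewrite (res_shift _ (x + r%:Z) (-1)) ?(negPf xNB) ?subrK // kE; ring.
  apply/affine_sumE => //; pose h x := f x - x.
  have hD x : h (x + k.+1%:Z) = h x by rewrite /h fD; ring.
  rewrite -/(h _) -(sum_residues hD (residue_affine_inj (affine_perm_id k))) /=.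
  rewrite (bigID (fun i => i \in B)) /=.
  have inBE (i : 'I_k.+1) : inB i.+1%:Z = (i \in B).
    rewrite /inB; congr (_ \in B); apply/val_inj/eqP.
    by rewrite -eqz_nat residueE -addn1 PoszD addrK modz_small //= ltz_nat ltn_ord.
  rewrite (eq_bigr (fun=> - r%:Z)) => [|i iB]; last by rewrite /h /f inBE iB; ring.
  rewrite [X in _ + X](eq_bigr (fun=> c%:Z)) => [|i iB]; last first.
    by rewrite /h /f inBE (negPf iB); ring.
  rewrite !sumr_const cB.
  have -> : #|[pred i | i \notin B]| = r.
    apply: (@addnI c); rewrite crk -{1}cB -[RHS](card_ord k.+1) -(cardC [in B]).
    by congr addn; apply: eq_card => i.
  by rewrite -(mulr_natr (- r%:Z)) -(mulr_natr c%:Z) !natz; ring.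
exists (affine_mk fP) => i; rewrite /= /affine_fun /= /f /inB.
have -> : residue k (i.+1%:Z - 1) = i; last by [].
apply/val_inj/eqP.
by rewrite -eqz_nat residueE -addn1 PoszD addrK modz_small //= ltz_nat ltn_ord.
Qed.

End WindowElement.

(** * The space R^(k+1) / R(1,...,1) and the alcoves *)

Section Alcoves.
Variables (R : realType) (k : nat).
Implicit Types (a b : 'rV[R]_k.+1) (i : 'I_k.+1) (w : affine_symm k).

Definition diag_line : {pred 'rV[R]_k.+1} := fun a => a == const_mx (a 0 0).

Lemma diag_line_zmod_closed : zmod_closed diag_line.
Proof.
split=> [|a b /eqP aE /eqP bE].
  by apply/eqP/rowP => j; rewrite !mxE.
by apply/eqP/rowP => j; rewrite aE bE !mxE.
Qed.

HB.instance Definition _ := GRing.isZmodClosed.Build _ diag_line diag_line_zmod_closed.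

Definition affine_space : Type := Quotient.quot diag_line.
HB.instance Definition _ := GRing.Zmodule.on affine_space.
HB.instance Definition _ := Quotient.on affine_space.

Implicit Types x y : affine_space.

Lemma affine_space_eqP a b :
  reflect (exists t : R, a = b + const_mx t) (a == b %[mod affine_space]).
Proof.
rewrite -[_ == _]Quotient.idealrBE; apply: (iffP eqP) => [abE|[t ->]].
  by exists ((a - b) 0 0); rewrite -abE addrC subrK.
by apply/rowP => j; rewrite !mxE addrAC subrr add0r addrAC subrr add0r.
Qed.

(* Ordinal j stands for the coordinate j + 1: for i != 0 the generator s_i swaps
   the ordinals i - 1 and i. *)
Definition gen_vec i a : 'rV[R]_k.+1 :=
  if i == ord0 then
    \row_j (if j == ord0 then a 0 ord_max + 1
            else if j == ord_max then a 0 ord0 - 1 else a 0 j)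
  else xcol (ord_pred i) i a.

Definition gen_act i x : affine_space := \pi_affine_space (gen_vec i (repr x)).

(* The action of w is the composite of the actions of the letters of a word of w;
   by affine_actE below every word of w gives the same result. *)
Definition affine_act w x : affine_space := foldr gen_act x (some_reduced_word w).

Lemma gen_vecD i a (t : R) : gen_vec i (a + const_mx t) = gen_vec i a + const_mx t.
Proof.
apply/rowP => j; rewrite /gen_vec; case: ifP => _; rewrite !mxE //.
by do 2?[case: ifP => _]; rewrite ?mxE // addrAC.
Qed.

Lemma gen_actE i a : gen_act i (\pi_affine_space a) = \pi_affine_space (gen_vec i a).
Proof.
apply/eqP/affine_space_eqP.
have [t ->] : exists t, repr (\pi_affine_space a) = a + const_mx t.
  by apply/affine_space_eqP; rewrite reprK.
by exists t; rewrite gen_vecD.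
Qed.

Lemma foldr_gen_actE (s : seq 'I_k.+1) a :
  foldr gen_act (\pi_affine_space a) s = \pi_affine_space (foldr gen_vec a s).
Proof. by elim: s => //= i s ->; rewrite gen_actE. Qed.

(* The coordinates of a vector extended to all integers by the rule
   a_(x + k + 1) = a_x - 1: every generator s_i acts on the extended family by
   permuting the indices. *)
Definition vec_ext a (z : int) : R :=
  a 0 (residue k (z - 1)) - ((z - 1) %/ k.+1)%Z%:~R.

Lemma vec_ext_coord a (j : 'I_k.+1) : vec_ext a j.+1%:Z = a 0 j.
Proof.
rewrite /vec_ext; have -> : j.+1%:Z - 1 = j by lia.
have -> : residue k (j : nat)%:Z = j.
  by apply/val_inj/eqP; rewrite -eqz_nat residueE modz_small //= ltz_nat ltn_ord.
by rewrite divz_small ?subr0 //= ltz_nat ltn_ord.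
Qed.

Lemma vec_extD a z : vec_ext a (z + k.+1%:Z) = vec_ext a z - 1.
Proof.
rewrite /vec_ext.
have -> : residue k (z + k.+1%:Z - 1) = residue k (z - 1).
  by apply/val_inj/eqP; rewrite -eqz_nat !residueE addrAC modzDr.
by rewrite (addrAC z) (divzDr (z - 1) (dvdzz _)) divzz /= rmorphD opprD addrA.
Qed.

Lemma vec_ext_inj a b : vec_ext a =1 vec_ext b -> a = b.
Proof. by move=> ab; apply/rowP => j; rewrite -!vec_ext_coord ab. Qed.

Hypothesis k_gt0 : (0 < k)%N.

Lemma vec_ext_gen i a z : vec_ext (gen_vec i a) z = vec_ext a (affine_gen i z).
Proof.
rewrite affine_genE //.
pose d (t : int) := vec_ext (gen_vec i a) (t + 1) - vec_ext a (affine_gen_fun i (t + 1)).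
have [_ sD _] := affine_gen_perm k_gt0 i.
have dD t : d (t + k.+1%:Z) = d t.
  by rewrite /d (addrAC t) sD !vec_extD opprD addrACA subrr addr0.
suff d0 : d (z - 1) = 0 by move/eqP: d0; rewrite /d subrK subr_eq0 => /eqP.
rewrite -(periodic_residue dD) /d; move: (residue _ _) => j {d dD}.
have -> : (j : nat)%:Z + 1 = j.+1%:Z by lia.
apply/eqP; rewrite subr_eq0 vec_ext_coord; apply/eqP.
have jP := ltn_ord j; have iP := ltn_ord i.
have up : (j.+1%:Z == (i : nat)%:Z %[mod k.+1])%Z = (j == ord_pred i).
  rewrite -val_eqE /= !modz_nat eqz_nat.
  have [i0|i_gt0] := posnP i.
    rewrite i0 add0n mod0n [in RHS]modn_small //.
    have [jk|jk] := eqVneq (j : nat) k; first by rewrite jk modnn.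
    by rewrite modn_small // ltn_neqAle jP andbT eqSS.
  rewrite [(i %% _)%N]modn_small //.
  have -> : ((i + k.+1).-1 = i.-1 + k.+1)%N by lia.
  rewrite modnDr [in RHS]modn_small; last by lia.
  have [jk|jk] := eqVneq (j : nat) k; first by rewrite jk modnn; lia.
  by rewrite modn_small; lia.
have down : (j.+1%:Z == (i : nat)%:Z + 1 %[mod k.+1])%Z = (j == i).
  rewrite -[(i : nat)%:Z + 1]/((i + 1)%N%:Z) addn1 !modz_nat eqz_nat -val_eqE.
  by rewrite -(addn1 j) -(addn1 i) eqn_modDr !modn_small.
have pred_i : (ord_pred i : nat) = if (i : nat) == 0%N then k else i.-1.
  rewrite /=; case: eqP => [->|/eqP i0]; first by rewrite modn_small.
  have -> : ((i + k.+1).-1 = i.-1 + k.+1)%N by lia.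
  by rewrite modnDr modn_small; lia.
rewrite /affine_gen_fun up down /gen_vec.
have [i0|iN0] := eqVneq i ord0.
  have -> : ord_pred i = ord_max by apply/ord_inj; rewrite pred_i i0.
  rewrite mxE i0; case: (eqVneq j ord_max) => [->|jm].
    rewrite ifF; last by apply/eqP => /(congr1 (@nat_of_ord _)) /=; lia.
    have -> : (@ord_max k).+1%:Z + 1 = (@ord0 k).+1%:Z + k.+1%:Z by rewrite /=; lia.
    by rewrite vec_extD vec_ext_coord.
  case: (eqVneq j ord0) => [->|j0]; last by rewrite vec_ext_coord.
  apply: (addIr (-1)); rewrite -vec_extD addrK.
  have -> : (@ord0 k).+1%:Z - 1 + k.+1%:Z = (@ord_max k).+1%:Z by rewrite /=; lia.
  by rewrite vec_ext_coord.
have i_gt0 : (0 < i)%N.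
  by rewrite lt0n; apply: contraNneq iN0 => i0; apply/eqP/ord_inj.
rewrite mxE; case: tpermP => [->|->|/eqP/negPf -> /eqP/negPf ->].
- rewrite eqxx -(vec_ext_coord a i); congr vec_ext.
  by rewrite pred_i gtn_eqF //; lia.
- rewrite eqxx ifF; last by apply/eqP => /(congr1 (@nat_of_ord _)); rewrite pred_i gtn_eqF //=; lia.
  rewrite -(vec_ext_coord a (ord_pred i)); congr vec_ext.
  by rewrite pred_i gtn_eqF //; lia.
- by rewrite vec_ext_coord.
Qed.

Lemma vec_ext_word (s : seq 'I_k.+1) a z :
  vec_ext (foldr gen_vec a s) z = vec_ext a (((affine_prod s)^-1%g : affine_symm k) z).
Proof.
elim: s z => [|i s IHs] z /=.
  by rewrite /affine_prod big_nil invg1.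
rewrite vec_ext_gen IHs /affine_prod big_cons invgM affine_symmM.
by rewrite affine_genV.
Qed.

Lemma affine_actE w (s : seq 'I_k.+1) x :
  affine_prod s = w -> affine_act w x = foldr gen_act x s.
Proof.
move=> sw; rewrite /affine_act -[x]reprK !foldr_gen_actE; congr (\pi_affine_space _).
apply: vec_ext_inj => z; rewrite !vec_ext_word sw.
by have [-> _] := some_reduced_wordP w k_gt0.
Qed.

Lemma affine_act1 x : affine_act 1%g x = x.
Proof. by rewrite (@affine_actE _ [::]) // /affine_prod big_nil. Qed.

Lemma affine_actM v w x : affine_act (v * w)%g x = affine_act v (affine_act w x).
Proof.
have [s sv] := affine_prod_surj k_gt0 v; have [t tw] := affine_prod_surj k_gt0 w.
rewrite (affine_actE _ sv) (affine_actE _ tw) -foldr_cat; apply: affine_actE.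
by rewrite /affine_prod big_cat -sv -tw.
Qed.

Lemma affine_act_gen i a :
  affine_act (affine_gen i) (\pi_affine_space a) = \pi_affine_space (gen_vec i a).
Proof.
by rewrite (@affine_actE _ [:: i]) /= ?gen_actE // /affine_prod big_seq1.
Qed.

Definition fund_alcove : set affine_space :=
  [set x | exists2 a : 'rV[R]_k.+1, x = \pi_affine_space a &
     (forall i j : 'I_k.+1, (i <= j)%N -> a 0 j <= a 0 i)
     /\ a 0 ord0 - 1 <= a 0 ord_max]%classic.

Definition alcove w : set affine_space :=
  (affine_act w^-1%g @` fund_alcove)%classic.

Definition translation_spec (gamma : affine_space) w : Prop :=
  alcove w = ((fun x => x + gamma) @` fund_alcove)%classic.

(* For gamma the class of an integer vector exactly one w satisfies
   translation_spec; the value for other gamma is irrelevant. *)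
Definition translation_elt (gamma : affine_space) : affine_symm k :=
  xget 1%g [set w | translation_spec gamma w]%classic.

Definition Gamma (c : nat) : set affine_space :=
  [set x | exists2 a : 'rV[R]_k.+1, x = \pi_affine_space a &
     (forall i, a 0 i = 0 \/ a 0 i = 1) /\ \sum_i a 0 i = c%:R]%classic.

End Alcoves.

(** * The affine nilCoxeter algebra *)

Section NilCoxeter.
Variables (F : comNzRingType) (k : nat).

Local Notation free_alg := {malg F[{fmonom 'I_k.+1}]}.
Implicit Types p q : free_alg.

Definition free_gen (i : 'I_k.+1) : free_alg := << fmu i >>.

(* ordS i is i + 1 modulo k + 1. For k = 1 there is no braid relation, as the
   affine symmetric group is then the infinite dihedral group. *)
Inductive nilcox_rel : free_alg -> Prop :=
  | NilCoxSquare i : nilcox_rel (free_gen i * free_gen i)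
  | NilCoxComm i j : j != ordS i -> i != ordS j ->
      nilcox_rel (free_gen i * free_gen j - free_gen j * free_gen i)
  | NilCoxBraid i : (1 < k)%N ->
      nilcox_rel (free_gen i * free_gen (ordS i) * free_gen i
                  - free_gen (ordS i) * free_gen i * free_gen (ordS i)).

Inductive nilcox_ideal : free_alg -> Prop :=
  | NilCoxIdealRel p : nilcox_rel p -> nilcox_ideal p
  | NilCoxIdeal0 : nilcox_ideal 0
  | NilCoxIdealB p q : nilcox_ideal p -> nilcox_ideal q -> nilcox_ideal (p - q)
  | NilCoxIdealMl p q : nilcox_ideal q -> nilcox_ideal (p * q)
  | NilCoxIdealMr p q : nilcox_ideal p -> nilcox_ideal (p * q).

Definition nilcox_idealb : {pred free_alg} := fun p => `[< nilcox_ideal p >].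

Lemma nilcox_ideal_zmod_closed : zmod_closed nilcox_idealb.
Proof.
split=> [|p q /asboolP pI /asboolP qI]; apply/asboolP; first exact: NilCoxIdeal0.
exact: NilCoxIdealB.
Qed.

HB.instance Definition _ :=
  GRing.isZmodClosed.Build _ nilcox_idealb nilcox_ideal_zmod_closed.

Definition nilcoxeter : Type := Quotient.quot nilcox_idealb.
HB.instance Definition _ := GRing.Zmodule.on nilcoxeter.
HB.instance Definition _ := Quotient.on nilcoxeter.

Lemma nilcox_eqP p q :
  reflect (\pi_nilcoxeter p = \pi_nilcoxeter q) (p - q \in nilcox_idealb).
Proof. by rewrite Quotient.idealrBE; apply: eqP. Qed.

Lemma nilcox_pi_surj (x : nilcoxeter) : exists p, x = \pi_nilcoxeter p.
Proof. by exists (repr x); rewrite reprK. Qed.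

Lemma nilcox_piD p q : \pi_nilcoxeter (p + q) = \pi_nilcoxeter p + \pi_nilcoxeter q.
Proof. exact: Quotient.pi_add. Qed.

Definition nilcox_one : nilcoxeter := \pi_nilcoxeter 1.
Definition nilcox_mul (x y : nilcoxeter) : nilcoxeter := \pi_nilcoxeter (repr x * repr y).
Definition nilcox_scale (t : F) (x : nilcoxeter) : nilcoxeter := \pi_nilcoxeter (t *: repr x).

Lemma nilcox_repr p : repr (\pi_nilcoxeter p) - p \in nilcox_idealb.
Proof. by apply/nilcox_eqP; rewrite reprK. Qed.

Lemma nilcox_mulE p q : nilcox_mul (\pi_nilcoxeter p) (\pi_nilcoxeter q) = \pi_nilcoxeter (p * q).
Proof.
apply/nilcox_eqP; set p' := repr _; set q' := repr _.
have -> : p' * q' - p * q = p' * (q' - q) + (p' - p) * q.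
  by rewrite mulrBr mulrBl addrA subrK.
have /asboolP qI := nilcox_repr q; have /asboolP pI := nilcox_repr p.
by rewrite rpredD //; apply/asboolP; [apply: NilCoxIdealMl | apply: NilCoxIdealMr].
Qed.

Lemma nilcox_scaleE t p : nilcox_scale t (\pi_nilcoxeter p) = \pi_nilcoxeter (t *: p).
Proof.
apply/nilcox_eqP; rewrite -scalerBr -mulr_algl.
by have /asboolP pI := nilcox_repr p; apply/asboolP/NilCoxIdealMl.
Qed.

Lemma nilcox_mulA : associative nilcox_mul.
Proof.
move=> x y z; have [p ->] := nilcox_pi_surj x; have [q ->] := nilcox_pi_surj y.
by have [s ->] := nilcox_pi_surj z; rewrite !nilcox_mulE mulrA.
Qed.

Lemma nilcox_mul1 : left_id nilcox_one nilcox_mul.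
Proof. by move=> x; have [p ->] := nilcox_pi_surj x; rewrite nilcox_mulE mul1r. Qed.

Lemma nilcox_mulr1 : right_id nilcox_one nilcox_mul.
Proof. by move=> x; have [p ->] := nilcox_pi_surj x; rewrite nilcox_mulE mulr1. Qed.

Lemma nilcox_mulDl : left_distributive nilcox_mul +%R.
Proof.
move=> x y z; have [p ->] := nilcox_pi_surj x; have [q ->] := nilcox_pi_surj y.
have [s ->] := nilcox_pi_surj z.
by rewrite -nilcox_piD !nilcox_mulE mulrDl nilcox_piD.
Qed.

Lemma nilcox_mulDr : right_distributive nilcox_mul +%R.
Proof.
move=> x y z; have [p ->] := nilcox_pi_surj x; have [q ->] := nilcox_pi_surj y.
have [s ->] := nilcox_pi_surj z.
by rewrite -nilcox_piD !nilcox_mulE mulrDr nilcox_piD.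
Qed.

Lemma nilcox_ideal_aug p : nilcox_ideal p -> p@_mone = 0.
Proof.
have gen0 i : (free_gen i)@_mone = 0.
  rewrite /free_gen mcoeffU; case: eqP => // i1.
  by have := congr1 (@fmonom_val _) i1; rewrite fmuE fm1.
have coefM p1 p2 : (p1 * p2)@_mone = p1@_mone * p2@_mone.
  by have [->] := mcoeff1g_is_multiplicative {fmonom 'I_k.+1} F.
have coefM0 i p1 : (free_gen i * p1)@_mone = 0 by rewrite coefM gen0 mul0r.
have coef0M i p1 p2 : (free_gen i * p1 * p2)@_mone = 0.
  by rewrite coefM coefM0 mul0r.
have coefB p1 p2 : p1@_mone = 0 -> p2@_mone = 0 -> (p1 - p2)@_mone = 0.
  by rewrite mcoeffB => -> ->; rewrite subrr.
elim=> [_ [i|i j _ _|i _]||q s _ q0 _ s0|q s _ s0|q s _ q0].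
- exact: coefM0.
- by apply: coefB; apply: coefM0.
- by apply: coefB; apply: coef0M.
- exact: mcoeff0.
- exact: coefB.
- by rewrite (coefM q) s0 mulr0.
- by rewrite (coefM q) q0 mul0r.
Qed.

Lemma nilcox_one_neq0 : nilcox_one != 0.
Proof.
have pi0 : \pi_nilcoxeter 0 = 0.
  by apply: (addrI (\pi_nilcoxeter 0)); rewrite -nilcox_piD !addr0.
rewrite -pi0; apply/eqP => /nilcox_eqP/asboolP/nilcox_ideal_aug/eqP.
by rewrite subr0 mcoeffUU oner_eq0.
Qed.

HB.instance Definition _ := GRing.Zmodule_isNzRing.Build nilcoxeter
  nilcox_mulA nilcox_mul1 nilcox_mulr1 nilcox_mulDl nilcox_mulDr nilcox_one_neq0.

Lemma nilcox_scaleA s t x :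
  nilcox_scale s (nilcox_scale t x) = nilcox_scale (s * t) x.
Proof.
by have [p ->] := nilcox_pi_surj x; rewrite !nilcox_scaleE scalerA.
Qed.

Lemma nilcox_scale1 : left_id 1 nilcox_scale.
Proof. by move=> x; have [p ->] := nilcox_pi_surj x; rewrite nilcox_scaleE scale1r. Qed.

Lemma nilcox_scaleDr : right_distributive nilcox_scale +%R.
Proof.
move=> t x y; have [p ->] := nilcox_pi_surj x; have [q ->] := nilcox_pi_surj y.
by rewrite -nilcox_piD !nilcox_scaleE scalerDr nilcox_piD.
Qed.

Lemma nilcox_scaleDl x : {morph nilcox_scale^~ x : s t / s + t}.
Proof.
move=> s t; have [p ->] := nilcox_pi_surj x.
by rewrite !nilcox_scaleE scalerDl nilcox_piD.
Qed.

HB.instance Definition _ := GRing.Zmodule_isLmodule.Build F nilcoxeter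
  nilcox_scaleA nilcox_scale1 nilcox_scaleDr nilcox_scaleDl.

Lemma nilcox_piM p q :
  \pi_nilcoxeter (p * q) = \pi_nilcoxeter p * \pi_nilcoxeter q.
Proof. exact/esym/nilcox_mulE. Qed.

Lemma nilcox_piZ t p : \pi_nilcoxeter (t *: p) = t *: (\pi_nilcoxeter p : nilcoxeter).
Proof. exact/esym/nilcox_scaleE. Qed.

Lemma nilcox_scaleAl (t : F) (x y : nilcoxeter) : t *: (x * y) = t *: x * y.
Proof.
have [p ->] := nilcox_pi_surj x; have [q ->] := nilcox_pi_surj y.
by rewrite -nilcox_piM -nilcox_piZ scalerAl nilcox_piM nilcox_piZ.
Qed.

HB.instance Definition _ := GRing.Lmodule_isLalgebra.Build F nilcoxeter
  nilcox_scaleAl.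

Lemma nilcox_scaleAr (t : F) (x y : nilcoxeter) : t *: (x * y) = x * (t *: y).
Proof.
have [p ->] := nilcox_pi_surj x; have [q ->] := nilcox_pi_surj y.
have scaleC : t *: (p * q) = p * (t *: q).
  have tC : malgC t * p = p * malgC t.
    rewrite !malgM_def fgmulUg fgmulgU; apply: eq_bigr => m _.
    by rewrite mulrC mul1m mulm1.
  by rewrite -(mul_malgC t q) mulrA -tC -mulrA mul_malgC.
by rewrite -nilcox_piM -nilcox_piZ scaleC nilcox_piM nilcox_piZ.
Qed.

HB.instance Definition _ := GRing.Lalgebra_isAlgebra.Build F nilcoxeter
  nilcox_scaleAr.

Definition nilcox_gen (i : 'I_k.+1) : nilcoxeter := \pi_nilcoxeter (free_gen i).

(* By Matsumoto's theorem the product does not depend on the reduced word. *)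
Definition nilcox_elt (w : affine_symm k) : nilcoxeter :=
  \prod_(i <- some_reduced_word w) nilcox_gen i.

End NilCoxeter.

Definition Y_rect (R : realType) (F : comNzRingType) (k c : nat) : nilcoxeter F k :=
  \sum_(gamma \in @Gamma R k c) nilcox_elt F (translation_elt gamma).

Definition W_rect (F : comNzRingType) (k c r : nat) : nilcoxeter F k :=
  \sum_(B : {set 'I_k.+1} | #|B| == c) nilcox_elt F (window_elt c r B).

(* Main.v *)
(* Extend a vector to Z by a_(x+k+1) = a_x - 1, so that the fundamental alcove
   consists of the weakly decreasing families and w^-1 acts by a |-> a \o w.
   Since j_B(i) is i + c - (k + 1) or i + c according as i is in B or not,
   a(j_B(i)) = a(i + c) + 1_B(i). The shift a |-> a(_ + c) preserves the
   fundamental alcove, so j_B^-1 maps it to its translate by the class of 1_B;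
   hence j_B = z_gamma for gamma = 1_B, and B |-> 1_B is a bijection onto Gamma. *)

Require Import Defs.
From mathcomp Require Import all_boot all_order all_algebra reals.
From mathcomp Require Import zify.
From mathcomp Require Import boolp classical_sets functions fsbigop.

Set Implicit Arguments.
Unset Strict Implicit.
Unset Printing Implicit Defensive.

Import Order.TTheory GRing.Theory Num.Theory.

Local Open Scope ring_scope.
Local Open Scope quotient_scope.

Section Rectangle.
Variables (R : realType) (k : nat).
Implicit Types (a b : 'rV[R]_k.+1) (v w : affine_symm k) (B : {set 'I_k.+1}).

Lemma affine_space_piD a b :
  \pi_(affine_space R k) (a + b) = \pi_(affine_space R k) a + \pi_(affine_space R k) b.
Proof. exact: Quotient.pi_add. Qed.

Definition step_decreasing (f : int -> R) : Prop := forall x, f (x + 1) <= f x.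

Lemma quasi_periodic_eq (f g : int -> R) :
  (forall x, f (x + k.+1%:Z) = f x - 1) ->
  (forall x, g (x + k.+1%:Z) = g x - 1) ->
  (forall j : 'I_k.+1, f j.+1%:Z = g j.+1%:Z) -> f =1 g.
Proof.
(* The difference is periodic; the shift by 1 turns the residues 0..k into the indices 1..k+1, where
   [fg] applies. *)
move=> fD gD fg x; pose d t := f (t + 1) - g (t + 1).
have dD t : d (t + k.+1%:Z) = d t.
  by rewrite /d (addrAC t) fD gD opprD addrACA subrr addr0.
have := periodic_residue dD (x - 1).
rewrite /d subrK; move: (residue _ _) => j.
have -> : (j : nat)%:Z + 1 = j.+1%:Z by lia.
by rewrite fg subrr => /esym/eqP; rewrite subr_eq0 => /eqP.
Qed.

Lemma vec_ext_const a t z : vec_ext (a + const_mx t) z = vec_ext a z + t.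
Proof. by rewrite /vec_ext !mxE addrAC. Qed.

(** Steps inside 1..k+1 compare consecutive coordinates, the step from k+1 to k+2 is the wrap-around
    inequality, and quasi-periodicity carries both to every step. *)
Lemma step_decreasing_vec_ext a :
  step_decreasing (vec_ext a) <->
  (forall i j : 'I_k.+1, (i <= j)%N -> a 0 j <= a 0 i)
  /\ a 0 ord0 - 1 <= a 0 ord_max.
Proof.
have wrap : vec_ext a ((@ord_max k).+1%:Z + 1) = a 0 ord0 - 1.
  by rewrite -(vec_ext_coord a ord0) -vec_extD; congr vec_ext; rewrite /=; lia.
split=> [decr | [decr wrap_le] x].
  split=> [i j ij|]; last by rewrite -wrap -(vec_ext_coord a ord_max); apply: decr.
  rewrite -!vec_ext_coord.
  have -> : j.+1%:Z = i.+1%:Z + (j - i)%N%:Z by lia.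
  elim: (j - i)%N => [|n IHn]; first by rewrite addr0.
  have -> : i.+1%:Z + n.+1%:Z = i.+1%:Z + n%:Z + 1 by lia.
  exact: le_trans IHn.
pose d t := vec_ext a (t + 1) - vec_ext a (t + 1 + 1).
have dD t : d (t + k.+1%:Z) = d t.
  by rewrite /d !(addrAC _ k.+1%:Z) !vec_extD opprD addrACA subrr addr0.
rewrite -subr_ge0; have := periodic_residue dD (x - 1); rewrite {2}/d subrK => <-.
move: (residue _ _) => j; rewrite /d subr_ge0.
have -> : (j : nat)%:Z + 1 = j.+1%:Z by lia.
have [->|jm] := eqVneq j ord_max; first by rewrite wrap vec_ext_coord.
have jk : (j.+1 < k.+1)%N.
  by rewrite ltn_neqAle ltn_ord andbT eqSS; apply: contraNneq jm => jk; apply/eqP/val_inj.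
have -> : j.+1%:Z + 1 = (Ordinal jk).+1%:Z by rewrite /=; lia.
by rewrite !vec_ext_coord; apply: decr => /=.
Qed.

(** The choice of representative is harmless: adding [const_mx t] adds t to the whole extension. *)
Lemma fund_alcoveE a :
  fund_alcove (\pi_(affine_space R k) a) <-> step_decreasing (vec_ext a).
Proof.
split=> [[b /eqP/affine_space_eqP[t ->]]|decr].
  by move/step_decreasing_vec_ext => decr x; rewrite !vec_ext_const lerD2r.
by exists a => //; apply/step_decreasing_vec_ext.
Qed.

Hypothesis k_gt0 : (0 < k)%N.

Lemma affine_act_vec_ext w a :
  exists2 b, affine_act w (\pi_(affine_space R k) a) = \pi_(affine_space R k) b &
    forall z, vec_ext b z = vec_ext a ((w^-1%g : affine_symm k) z).
Proof.
have [s sw] := affine_prod_surj k_gt0 w.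
exists (foldr (@gen_vec R k) a s).
  by rewrite (affine_actE k_gt0 _ sw) foldr_gen_actE.
by move=> z; rewrite vec_ext_word // sw.
Qed.

Lemma alcoveE w (x : affine_space R k) :
  alcove w x <-> fund_alcove (affine_act w x).
Proof.
split=> [[y yF <-]|wxF]; first by rewrite -affine_actM // mulgV affine_act1.
by exists (affine_act w x); rewrite // -affine_actM // mulVg affine_act1.
Qed.

(** Gives the uniqueness of z_gamma: two elements meeting [translation_spec] for the same weight
    have the same alcove. *)
Lemma alcove_inj : injective (@alcove R k).
Proof.
move=> v w vw; pose N : R := k.+1%:R.
have N_gt0 : 0 < N by rewrite ltr0n.
(* a lies in the interior of the fundamental alcove: its extension is strictly
   decreasing, so only the identity keeps it weakly decreasing. *)
pose a : 'rV[R]_k.+1 := \row_j (- (j.+1%:R / N)).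
have aE x : vec_ext a x = - (x%:~R / N).
  move: x; apply: quasi_periodic_eq => [x|x|j].
  - exact: vec_extD.
  - by rewrite rmorphD /= mulrDl divff ?opprD // gt_eqF.
  - by rewrite vec_ext_coord mxE.
(* b represents v^-1 acting on a, a point of the alcove of v; its extension is that of a composed
   with v. *)
have [b vb bE] := affine_act_vec_ext v^-1%g a.
have : alcove v (\pi_(affine_space R k) b).
  apply/alcoveE; rewrite -vb -affine_actM // mulgV affine_act1 //.
  apply/fund_alcoveE => x; rewrite !aE lerN2 ler_pM2r ?invr_gt0 // ler_int.
  by rewrite lerDl.
rewrite vw => /alcoveE; have [b' -> b'E] := affine_act_vec_ext w b.
move/fund_alcoveE => decr.
(* The extension of b' is x |-> -(v w^-1)(x) / N, so [decr] rules out descents of v w^-1 and leaves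
   only the identity. *)
apply: (mulIg w^-1%g); rewrite mulgV.
case: (affine_descent k_gt0 (v * w^-1)%g) => [//|[i]].
rewrite ltNge => /negP[]; have := decr (i : nat)%:Z.
by rewrite !b'E !bE invgK !aE lerN2 ler_pM2r ?invr_gt0 // ler_int.
Qed.

Definition indicator_row B : 'rV[R]_k.+1 := \row_i (i \in B)%:R.

Lemma sum_indicator_row B : \sum_i indicator_row B 0 i = #|B|%:R.
Proof.
by under eq_bigr do rewrite mxE; rewrite -natr_sum -big_mkcond sum1_card.
Qed.

Definition weight_of_set B : affine_space R k := \pi_(affine_space R k) (indicator_row B).

(** Fixing the size matters: the empty and full sets give the same class. Representatives of equal
    classes differ by a constant t, and comparing coordinate sums gives (k+1) t = 0. *)
Lemma weight_of_set_inj c :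
  {in [set B : {set 'I_k.+1} | #|B| = c]%classic &, injective weight_of_set}.
Proof.
move=> B B' /set_mem /= cB /set_mem /= cB' /eqP/affine_space_eqP[t BB'].
have t0 : t = 0.
  have := sum_indicator_row B; rewrite BB'.
  under eq_bigr do rewrite mxE; rewrite big_split /= sum_indicator_row cB cB'.
  under eq_bigr do rewrite mxE; rewrite sumr_const card_ord -[RHS]addr0.
  by move/addrI/eqP; rewrite mulrn_eq0 /= => /eqP.
apply/setP => i; move/rowP/(_ i)/eqP: BB'.
by rewrite t0 !mxE addr0 eqr_nat; case: (i \in B) (i \in B') => [] [].
Qed.

Lemma GammaE c : Gamma (R:=R) (k:=k) c =
  (weight_of_set @` [set B : {set 'I_k.+1} | #|B| = c])%classic.
Proof.
apply/seteqP; split=> x /= [].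
  move=> a -> [a01 suma]; pose B := [set i | a 0 i == 1].
  have aB : a = indicator_row B.
    apply/rowP => i; rewrite !mxE inE; case: (a01 i) => ->.
      by rewrite eq_sym oner_eq0.
    by rewrite eqxx.
  exists B; last by rewrite /weight_of_set -aB.
  by move: suma; rewrite aB sum_indicator_row => /eqP; rewrite eqr_nat => /eqP.
move=> B cB <-; exists (indicator_row B) => //.
split=> [i|]; last by rewrite sum_indicator_row cB.
by rewrite mxE; case: (i \in B); [right|left].
Qed.

Lemma vec_ext_window c r B w a b : (c + r)%N = k.+1 -> window_spec c r B w ->
  (forall z, vec_ext b z = vec_ext a ((w^-1%g : affine_symm k) z)) ->
  forall x, vec_ext (a - indicator_row B) x = vec_ext b (x + c%:Z).
Proof.
move=> cr wP bE; apply: quasi_periodic_eq => [x|x|j]; first exact: vec_extD.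
  by rewrite addrAC vec_extD.
have bw : vec_ext b (w j.+1%:Z) = a 0 j.
  by rewrite bE affine_symmVK vec_ext_coord.
rewrite vec_ext_coord !mxE -bw wP; case: ifP => _; last by rewrite subr0.
(* For j in B, w(j+1) = j+1-r = (j+1+c) - (k+1), and moving up by k+1 to the index j+1+c lowers the
   value by 1. *)
by rewrite -vec_extD; congr vec_ext; lia.
Qed.

(** Membership in either set says that an extension decreases; the two extensions differ only by the
    index shift c, which preserves this property. *)
Lemma translation_spec_window c r B w :
  (c + r)%N = k.+1 -> window_spec c r B w -> translation_spec (weight_of_set B) w.
Proof.
move=> cr wP; apply/seteqP.
suff H x : alcove w x <-> fund_alcove (x - weight_of_set B).
  split=> x; last by case=> y yF <-; apply/H; rewrite addrK.
  by move/H => xF; exists (x - weight_of_set B) => //; rewrite subrK.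
have [a ->] : exists a, x = \pi_(affine_space R k) a by exists (repr x); rewrite reprK.
have [b wa bE] := affine_act_vec_ext w a.
have -> : \pi a - weight_of_set B = \pi_(affine_space R k) (a - indicator_row B).
  by apply: (addIr (weight_of_set B)); rewrite subrK -affine_space_piD subrK.
have shift := vec_ext_window cr wP bE.
split=> [/alcoveE|/fund_alcoveE decr].
  rewrite wa => /fund_alcoveE decr; apply/fund_alcoveE => x'.
  by rewrite !shift addrAC.
apply/alcoveE; rewrite wa; apply/fund_alcoveE => x'.
by have := decr (x' - c%:Z); rewrite !shift addrAC !subrK.
Qed.

Lemma translation_elt_window c r B :
  (c + r)%N = k.+1 -> #|B| = c ->
  translation_elt (weight_of_set B) = window_elt c r B.
Proof.
move=> cr cB; have tP := translation_spec_window cr (window_eltP cr cB).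
rewrite /translation_elt; apply: alcove_inj; rewrite tP.
(* By [tP] a solution exists, so [xget] returns a solution rather than falling back on its
   default. *)
exact: (xgetI 1%g tP).
Qed.

End Rectangle.

Theorem theorem3p18 (R : realType) (F : comNzRingType) (k c r : nat)
    (k_ge1 : (1 <= k)%N) (c_ge1 : (1 <= c)%N) (r_ge1 : (1 <= r)%N)
    (cr : (c + r)%N = k.+1) :
  Y_rect R F k c = W_rect F k c r.
Proof.
(* Both sides become finitely supported sums over the c-subsets B: the left by reindexing along B
   |-> 1_B, the right by [bigfs]. *)
rewrite /Y_rect GammaE fsbig_image; last exact: weight_of_set_inj.
rewrite /W_rect [RHS](bigfs _ (index_enum_uniq _)) => [|B _]; last first.
  by rewrite mem_index_enum.
have -> : [set B : {set 'I_k.+1} | #|B| = c]%classic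
    = [set` [pred B : {set 'I_k.+1} | #|B| == c]]%classic.
  by apply/seteqP; split=> B /eqP.
by apply: eq_fsbigr => B /set_mem /eqP cB; rewrite (translation_elt_window R k_ge1 cr cB).
Qed.
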